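(* Let $\varepsilon\in(0,1/2)$, let $(\mathcal{N},\mathcal{I})$ be a $k$-system on a ground set of size $n$, let $f:2^{\mathcal{N}}\to\mathbb{R}_{\ge0}$ be non-negative submodular, and run FastSGS with $\ell=\lfloor2+\sqrt{k+2}\rfloor$ solutions and parameter $\varepsilon$. Then FastSGS makes $\tilde O(kn/\varepsilon)$ oracle calls and produces an independent set whose approximation ratio is at most $(1-2\varepsilon)^{-2}(1+\sqrt{k+2})^2$. Moreover, when $f$ is non-negative monotone submodular and $\ell=1$, the approximation ratio improves to $(1-\varepsilon)^{-2}(k+1)$.
   Context: $\mathcal{N}$ finite ground set, $|\mathcal{N}|=n$. $f$ submodular: $f(X\cup Y)+f(X\cap Y)\le f(X)+f(Y)$; monotone: $f(A)\le f(B)$ for $A\subseteq B$; $f(u\mid S)=f(S\cup\{u\})-f(S)$; $S+u=S\cup\{u\}$. An independence system is a non-empty down-closed $\mathcal{I}\subseteq2^{\mathcal{N}}$; a base of $B\subseteq\mathcal{N}$ is a maximal independent subset of $B$; it is a $k$-system if for every $B\subseteq\mathcal{N}$ any two bases of $B$ have size ratio at most $k$. Assume $\{u\}\in\mathcal{I}$ for all $u$. $OPT$ maximizes $f$ over $\mathcal{I}$; approximation ratio at most $\alpha$ means $f(S)\ge f(OPT)/\alpha$. Oracle calls are calls to the value oracle for $f$ and independence oracle for $\mathcal{I}$; $\tilde O$ hides polylogarithmic factors. FastSGS$(\mathcal{N},f,\mathcal{I},\ell,\varepsilon)$: initialize $\ell$ solutions $S^{(1)},\dots,S^{(\ell)}$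 to $\varnothing$ and an available set equal to $\mathcal{N}$. Let $\Delta_f=\max_{u\in\mathcal{N}}f(\{u\})$ and $\tau=\Delta_f$. While $\tau>(\varepsilon/n)\Delta_f$: for every pair $(u,j)$ with $u$ in the current available set and $1\le j\le\ell$, if $S^{(j)}+u\in\mathcal{I}$ and $f(u\mid S^{(j)})\ge\tau$, add $u$ to $S^{(j)}$ and remove $u$ from the available set; after the pass set $\tau\leftarrow(1-\varepsilon)\tau$. Output the set maximizing $f$ among $S^{(1)},\dots,S^{(\ell)}$. *)

(* Defs.v *)
From HB Require Import structures.
From mathcomp Require Import all_boot all_order all_algebra.
From mathcomp Require Import reals exp.

Set Implicit Arguments.
Unset Strict Implicit.
Unset Printing Implicit Defensive.

Import Order.TTheory GRing.Theory Num.Theory.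
Local Open Scope ring_scope.

Definition submodular (R : realType) (T : finType) (f : {set T} -> R) : Prop :=
  forall X Y : {set T}, f (X :|: Y) + f (X :&: Y) <= f X + f Y.

Definition nonnegative (R : realType) (T : finType) (f : {set T} -> R) : Prop :=
  forall X : {set T}, 0 <= f X.

Definition monotone (R : realType) (T : finType) (f : {set T} -> R) : Prop :=
  forall A B : {set T}, A \subset B -> f A <= f B.

Definition independence_system (T : finType) (I : {set {set T}}) : Prop :=
  I != set0 /\ (forall A B : {set T}, A \subset B -> B \in I -> A \in I).

Definition is_base (T : finType) (I : {set {set T}}) (B A : {set T}) : Prop :=
  maxset (fun X : {set T} => (X \in I) && (X \subset B)) A.

(* The ratio condition #|A1| / #|A2| <= k is cleared of its denominator; if
   #|A2| = 0 then every base of B is empty and the condition holds. *)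
Definition k_system (R : realType) (k : R) (T : finType) (I : {set {set T}}) :
    Prop :=
  independence_system I /\
  forall B A1 A2 : {set T}, is_base I B A1 -> is_base I B A2 ->
    (#|A1|%:R : R) <= k * #|A2|%:R.

Definition approximation_ratio_le (R : realType) (T : finType)
    (f : {set T} -> R) (I : {set {set T}}) (S : {set T}) (alpha : R) : Prop :=
  forall OPT : {set T}, OPT \in I -> (forall A, A \in I -> f A <= f OPT) ->
    f OPT / alpha <= f S.

(* Values paired with the number of oracle calls made to compute them; the
   algorithm accesses f and I only through ask_value and ask_indep. *)
Definition counted (A : Type) : Type := (nat * A)%type.

Definition cret (A : Type) (a : A) : counted A := (0%N, a).

Definition cbind (A B : Type) (m : counted A) (g : A -> counted B) :
    counted B :=
  ((m.1 + (g m.2).1)%N, (g m.2).2).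

Definition ask_value (R : realType) (T : finType) (f : {set T} -> R)
    (S : {set T}) : counted R := (1%N, f S).

Definition ask_indep (T : finType) (I : {set {set T}}) (S : {set T}) :
    counted bool := (1%N, S \in I).

Definition ask_values (R : realType) (T : finType) (f : {set T} -> R)
    (Ss : seq {set T}) : counted (seq R) :=
  foldr (fun S m => cbind (ask_value f S) (fun v =>
                    cbind m (fun vs => cret (v :: vs))))
        (cret [::]) Ss.

Record sgs_state (T : finType) (l : nat) := SGSState {
  avail : {set T};
  sol : {ffun 'I_l -> {set T}}
}.

Definition sgs_init (T : finType) (l : nat) : sgs_state T l :=
  SGSState [set: T] [ffun=> set0].

Definition sgs_add (T : finType) (l : nat) (u : T) (j : 'I_l)
    (s : sgs_state T l) : sgs_state T l :=
  SGSState (avail s :\ u)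
           [ffun i => if i == j then u |: sol s i else sol s i].

Definition sgs_pair (R : realType) (T : finType) (f : {set T} -> R)
    (I : {set {set T}}) (l : nat) (tau : R) (p : T * 'I_l)
    (s : sgs_state T l) : counted (sgs_state T l) :=
  let: (u, j) := p in
  if u \in avail s then
    cbind (ask_indep I (u |: sol s j)) (fun b =>
    if b then
      cbind (ask_value f (u |: sol s j)) (fun v1 =>
      cbind (ask_value f (sol s j)) (fun v0 =>
      cret (if tau <= v1 - v0 then sgs_add u j s else s)))
    else cret s)
  else cret s.

Definition sgs_pass (R : realType) (T : finType) (f : {set T} -> R)
    (I : {set {set T}}) (l : nat) (tau : R) (ps : seq (T * 'I_l))
    (s : sgs_state T l) : counted (sgs_state T l) :=
  foldl (fun m p => cbind m (sgs_pair f I tau p)) (cret s) ps.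

(* The order in which a pass visits the pairs is not prescribed: a schedule
   fixes an arbitrary order for each pass, and pairs whose element is no longer
   available are skipped by sgs_pair. *)
Definition schedule (T : finType) (l : nat) (ord : nat -> seq (T * 'I_l)) :
    Prop :=
  forall i : nat, perm_eq (ord i) (enum [set: T * 'I_l]).

(* sgs_loop f I eps thr ord i tau m r: starting at pass number i with current
   threshold tau, the loop "while tau > thr" turns m into r and halts. *)
Inductive sgs_loop (R : realType) (T : finType) (f : {set T} -> R)
    (I : {set {set T}}) (l : nat) (eps thr : R)
    (ord : nat -> seq (T * 'I_l)) :
    nat -> R -> counted (sgs_state T l) -> counted (sgs_state T l) -> Prop :=
| SGSStop (i : nat) (tau : R) (m : counted (sgs_state T l)) :
    ~ (thr < tau) -> sgs_loop f I eps thr ord i tau m m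
| SGSStep (i : nat) (tau : R) (m r : counted (sgs_state T l)) :
    thr < tau ->
    sgs_loop f I eps thr ord i.+1 ((1 - eps) * tau)
      (cbind m (sgs_pass f I tau (ord i))) r ->
    sgs_loop f I eps thr ord i tau m r.

(* The default 0 is harmless: the objective is non-negative. *)
Definition ask_Delta (R : realType) (T : finType) (f : {set T} -> R) :
    counted R :=
  cbind (ask_values f [seq [set u] | u <- enum T]) (fun vs =>
  cret (\big[Num.max/0]_(v <- vs) v)).

(* FastSGS halts, having made q oracle calls, with output S. Ties in the final
   maximization may be broken in any way. *)
Definition fastSGS_run (R : realType) (T : finType) (f : {set T} -> R)
    (I : {set {set T}}) (l : nat) (eps : R) (ord : nat -> seq (T * 'I_l))
    (S : {set T}) (q : nat) : Prop :=
  let Delta := ask_Delta f in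
  exists r : counted (sgs_state T l),
    [/\ sgs_loop f I eps (eps / #|T|%:R * Delta.2) ord 0 Delta.2
          (cbind Delta (fun=> cret (sgs_init T l))) r,
        q = (cbind r (fun s => ask_values f [seq sol s j | j <- enum 'I_l])).1 &
        exists j : 'I_l,
          S = sol r.2 j /\ forall i : 'I_l, f (sol r.2 i) <= f (sol r.2 j)].

(* FastSGS halts under every schedule, and each of its possible outputs is
   independent, has ratio at most alpha and costs at most Q oracle calls. *)
Definition fastSGS_guarantee (R : realType) (T : finType) (f : {set T} -> R)
    (I : {set {set T}}) (l : nat) (eps Q alpha : R) : Prop :=
  forall ord : nat -> seq (T * 'I_l), schedule ord ->
    (exists (S : {set T}) (q : nat), fastSGS_run f I eps ord S q) /\
    forall (S : {set T}) (q : nat), fastSGS_run f I eps ord S q ->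
      [/\ q%:R <= Q, S \in I & approximation_ratio_le f I S alpha].

(* With h the leading term, a quantity is softO of h if it is at most
   polylog_bound C c h for constants C and c independent of the instance. Here
   h = k n / eps > 2, so ln h is bounded away from 0. *)
Definition polylog_bound (R : realType) (C : R) (c : nat) (h : R) : R :=
  C * h * ln h ^+ c.

(* Main.v *)
(* Fix an independent set O and one of the solutions S. An element of O outside
   S is either blocked by S while available, or taken by another solution, or
   still available at the end. At most k |S'| elements are blocked by a prefix
   S' of S and the thresholds decrease, so the gains of blocked elements
   are paid for by k (f S - f set0); an element taken by another solution
   was available to S just before, so its gain is paid for by the gain of that
   solution, up to 1 - eps; the remaining gains are below the last threshold.
   Summing over the l disjoint solutions, with submodularity giving
   sum_j f (O u S_j) >= (l - 1) f O, yields the ratio. The tail of size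
   eps * Delta is absorbed without loss because the best solution already has
   value at least (1 - eps) * Delta as soon as one element has been added, and
   Delta <= 3 f set0 otherwise. *)

Require Import Defs.
From mathcomp Require Import all_boot all_order all_algebra.
From mathcomp Require Import reals sequences exp.
From mathcomp Require Import ring lra.

Set Implicit Arguments.
Unset Strict Implicit.
Unset Printing Implicit Defensive.

Import Order.TTheory GRing.Theory Num.Theory.
Local Open Scope ring_scope.

(** * Marginal gains of a submodular function *)

Section Gains.

Variables (R : realType) (T : finType) (f : {set T} -> R).

Definition gain (S : {set T}) (u : T) : R := f (u |: S) - f S.

(** Since [f] need not be monotone, gains may be negative. Truncation at 0 lets sums of gains over
    subsets be compared freely and makes antitonicity in [S] hold even when [u] lies in the larger
    set. *)
Definition pos_gain (S : {set T}) (u : T) : R := Num.max 0 (gain S u).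

Lemma pos_gain_ge0 (S : {set T}) (u : T) : 0 <= pos_gain S u.
Proof. by rewrite le_max lexx. Qed.

Lemma pos_gain_le (S : {set T}) (u : T) (b : R) :
  0 <= b -> gain S u <= b -> pos_gain S u <= b.
Proof. by move=> b0 gb; rewrite ge_max b0. Qed.

Lemma gain_mem (S : {set T}) (u : T) : u \in S -> gain S u = 0.
Proof. by move=> uS; rewrite /gain (setUidPr _) ?subrr // sub1set. Qed.

Hypothesis f_sub : submodular f.

Lemma gain_antitone (S S' : {set T}) (u : T) :
  S \subset S' -> u \notin S' -> gain S' u <= gain S u.
Proof.
move=> sSS' uS'; have := f_sub (u |: S) S'.
have -> : u |: S :|: S' = u |: S' by rewrite -setUA (setUidPr sSS').
have -> : (u |: S) :&: S' = S.
  rewrite setIUl (setIidPl sSS') (_ : [set u] :&: S' = set0) ?set0U //.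
  by apply/setP=> v; rewrite !inE; case: eqP => // ->; rewrite (negPf uS').
by rewrite /gain; lra.
Qed.

Lemma pos_gain_antitone (S S' : {set T}) (u : T) :
  S \subset S' -> pos_gain S' u <= pos_gain S u.
Proof.
move=> sSS'; apply: pos_gain_le (pos_gain_ge0 _ _) _.
case: (boolP (u \in S')) => uS'; first by rewrite gain_mem // pos_gain_ge0.
by apply: le_trans (gain_antitone sSS' uS') _; rewrite le_max lexx orbT.
Qed.

Lemma value_union_le (O S : {set T}) :
  f (O :|: S) <= f S + \sum_(u in O) pos_gain S u.
Proof.
rewrite -big_enum /= -{1}(set_enum O); elim: (enum O) => [|u r IHr].
  by rewrite big_nil addr0 (_ : [set:: [::]] = set0) ?set0U // -set_nil.
rewrite big_cons set_cons -setUA.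
have /(pos_gain_antitone u) : S \subset [set:: r] :|: S by apply: subsetUr.
have : gain ([set:: r] :|: S) u <= pos_gain ([set:: r] :|: S) u.
  by rewrite le_max lexx orbT.
by move: IHr; rewrite /gain; lra.
Qed.

Lemma sum_value_union_disjoint (J : finType) (O : {set T}) (S : J -> {set T}) :
  nonnegative f -> (forall i j u, u \in S i -> u \in S j -> i = j) ->
  (#|J|%:R - 1) * f O <= \sum_j f (O :|: S j).
Proof.
move=> f_ge0 disj.
(* Keeping the value of the merged union makes the induction go through: by disjointness,
   submodularity merges one more [S j] at the price of one [f O]. Nonnegativity discards the union
   only at the end. *)
suff H (r : seq J) : uniq r ->
    (size r)%:R * f O + f (O :|: \bigcup_(j <- r) S j) <=
    \sum_(j <- r) f (O :|: S j) + f O.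
  have := H (enum J) (enum_uniq _); rewrite -cardE !big_enum /=.
  by have := f_ge0 (O :|: \bigcup_j S j); rewrite mulrBl mul1r; lra.
elim: r => [_|j r IHr /= /andP[jr ur]].
  by rewrite !big_nil setU0 mul0r.
rewrite !big_cons -addn1 natrD.
have := f_sub (O :|: S j) (O :|: \bigcup_(i <- r) S i).
have -> : (O :|: S j) :&: (O :|: \bigcup_(i <- r) S i) = O.
  rewrite -setUIr (_ : _ :&: _ = set0) ?setU0 //; apply/setP=> u.
  rewrite !inE; apply/negP=> /andP[uj]; rewrite bigcup_seq.
  by case/bigcupP=> i ir ui; move: jr; rewrite (disj _ _ _ uj ui) ir.
rewrite -setUUr; move: (IHr ur); lra.
Qed.

End Gains.

(** * Cardinality bounds in a k-system *)

(** [S] is a base of [S :|: D], because no element of [D] extends it; [D] is independent and extends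
    to another base, so the two bases can be compared. *)
Lemma card_blocked_le (R : realType) (k : R) (T : finType) (I : {set {set T}})
    (O S D : {set T}) :
  k_system k I -> O \in I -> S \in I -> D \subset O ->
  (forall u, u \in D -> u |: S \notin I) -> (#|D|%:R : R) <= k * #|S|%:R.
Proof.
move=> [[_ down] ksys] OI SI sDO blocked.
pose P := [pred X : {set T} | (X \in I) && (X \subset S :|: D)].
have PD : P D by rewrite /= (down _ _ sDO OI) subsetUr.
have [A baseA sDA] := maxset_exists PD.
apply: le_trans (ksys (S :|: D) A S baseA _).
  by rewrite ler_nat subset_leq_card.
apply/maxsetP; split=> [|X /andP[XI sX] sSX]; first by rewrite SI subsetUl.
apply/eqP; rewrite eqEsubset sSX andbT; apply/subsetP=> u uX.
move: (subsetP sX u uX); rewrite inE => /orP[//|/blocked/negP[]].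
by apply: down XI; rewrite subUset sub1set uX.
Qed.

Lemma k_system_ge1 (R : realType) (k : R) (T : finType) (I : {set {set T}})
    (u : T) : k_system k I -> [set u] \in I -> 1 <= k.
Proof.
move=> [[_ down] ksys] uI.
have base : is_base I [set u] [set u].
  apply/maxsetP; split=> [|X /andP[_ sX] sSX]; first by rewrite uI subxx.
  by apply/eqP; rewrite eqEsubset sX.
by have := ksys _ _ _ base base; rewrite cards1 mulr1.
Qed.

(** * Charging the gains of [O] to the solutions *)

Section Charging.

Variables (R : realType) (T : finType) (f : {set T} -> R) (I : {set {set T}}).
Variables (k eps : R) (O : {set T}).
Hypotheses (ksys : k_system k I) (k_ge0 : 0 <= k) (eps_lt1 : eps < 1).
Hypotheses (f_sub : submodular f) (O_indep : O \in I).

Let subeps_gt0 : 0 < 1 - eps. Proof. by rewrite subr_gt0. Qed.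

(* [A] is the available set, [S] one of the solutions, [H] the total gain of
   the other ones and [B] a bound on the gains of the elements that can still
   be added to [S]. [D] collects the elements of [O] that [S] blocked while
   they were available and [E] those taken by another solution before that.
   The term [(k * #|S| - #|D|) * B] is credit for elements not yet blocked; it
   replaces a summation by parts over the history of [S]. *)
Definition charged (A S : {set T}) (H B : R) : Prop :=
  exists D E : {set T},
  [/\ forall u, u \in O ->
        [|| u \in S, u \in D, u \in E | (u \in A) && (u |: S \in I)],
      D \subset O,
      forall u, u \in D -> u |: S \notin I,
      (1 - eps) * (\sum_(u in D) pos_gain f S u + (k * #|S|%:R - #|D|%:R) * B)
        <= k * (f S - f set0)
    & (1 - eps) * \sum_(u in E) pos_gain f S u <= H].

Lemma charged_init (B : R) : (forall u : T, [set u] \in I) ->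
  charged [set: T] set0 0 B.
Proof.
move=> sing; exists set0, set0; split=> [u _||u||].
- by rewrite !inE setU0 sing.
- exact: sub0set.
- by rewrite inE.
- by rewrite big_set0 !cards0 subrr !mulr0 subrr mul0r addr0 mulr0.
- by rewrite big_set0 mulr0.
Qed.

(** The credit has a nonnegative coefficient by [card_blocked_le], so lowering the price [B] only
    weakens the inequality. *)
Lemma charged_bound_le (A S : {set T}) (H B B' : R) :
  S \in I -> B' <= B -> charged A S H B -> charged A S H B'.
Proof.
move=> SI leB [D [E [cover sDO blocked chD chE]]].
exists D, E; split=> //; apply: le_trans chD.
rewrite ler_pM2l //.
rewrite lerD2l ler_wpM2l // subr_ge0.
exact: card_blocked_le ksys O_indep SI sDO blocked.
Qed.

(** The larger [S] earns new credit [k * B], paid for by the gain of [u], which is at least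
    [(1 - eps) * B]. Each element of [O] newly blocked moves from available to [D] and spends credit
    [B], which covers its gain. *)
Lemma charged_add_self (A S : {set T}) (H B tau : R) (u : T) :
  0 <= B -> 0 < tau -> (1 - eps) * B <= tau -> tau <= gain f S u ->
  (forall v, v \in A -> v |: S \in I -> gain f S v <= B) ->
  charged A S H B -> charged (A :\ u) (u |: S) H B.
Proof.
move=> B0 tau0 Btau gu bnd [D [E [cover sDO blocked chD chE]]].
have [[_ down] _] := ksys.
have uS : u \notin S.
  by apply: contraL gu => uS; rewrite (gain_mem _ uS) -ltNge.
have sS (v : T) : v |: S \subset v |: (u |: S) by rewrite setUS // subsetUr.
pose N := [set v in O | [&& v \in A, v |: S \in I & v |: (u |: S) \notin I]].
have dDN : [disjoint D & N].
  rewrite disjoint_subset; apply/subsetP=> v /blocked vS.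
  by rewrite !inE (negPf vS) !andbF.
have cardDN : #|D :|: N| = (#|D| + #|N|)%N.
  by apply/eqP; rewrite (leq_card_setU D N).
exists (D :|: N), E; split=> [v vO||v||].
- have := cover v vO; rewrite !inE.
  case: (v \in S); first by rewrite /= ?orbT.
  case: (v \in D); first by rewrite /= ?orbT.
  case: (v \in E); first by rewrite /= ?orbT.
  rewrite vO /= => /andP[-> ->] /=.
  by case: (v == u) => //=; case: (_ \in I); rewrite ?orbT.
- by rewrite subUset sDO; apply/subsetP=> v; rewrite inE => /andP[].
- rewrite inE => /orP[/blocked|]; last by rewrite inE => /and4P[].
  by apply: contra; apply: down.
- rewrite (big_setID D) /= setUK setDUl setDv set0U.
  have -> : N :\: D = N.
    by apply/setDidPl; rewrite disjoint_sym.
  have leD : \sum_(v in D) pos_gain f (u |: S) v <=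
      \sum_(v in D) pos_gain f S v.
    by apply: ler_sum => v _; apply: pos_gain_antitone => //; apply: subsetUr.
  have leN : \sum_(v in N) pos_gain f (u |: S) v <= #|N|%:R * B.
    rewrite mulr_natl -sumr_const; apply: ler_sum => v.
    rewrite inE => /and4P[_ vA vS _].
    apply: le_trans (pos_gain_antitone f_sub _ (subsetUr [set u] S)) _.
    exact: pos_gain_le B0 (bnd _ vA vS).
  rewrite cardDN cardsU1 uS add1n -natr1 natrD.
  have -> : f (u |: S) = f S + gain f S u by rewrite /gain; lra.
  move: chD leD leN; set d := \sum_(v in D) _; set d' := \sum_(v in D) _.
  set n' := \sum_(v in N) _ => chD leD leN.
  have kB : k * ((1 - eps) * B) <= k * gain f S u.
    by rewrite ler_wpM2l // (le_trans Btau).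
  have : (1 - eps) * (d' + n') <= (1 - eps) * (d + #|N|%:R * B).
    by rewrite ler_pM2l ?lerD.
  lra.
- apply: le_trans chE; rewrite ler_pM2l //.
  by apply: ler_sum => v _; apply: pos_gain_antitone => //; apply: subsetUr.
Qed.

(** If [S] could have taken [u], then [u] joins [E] and its gain, at most [B], is paid for by the
    growth of [H]. If [S] blocks [u], the covering clause already puts any such [u] of [O] in [S],
    [D] or [E]. *)
Lemma charged_add_other (A S : {set T}) (H H' B : R) (u : T) :
  0 <= B -> H + (1 - eps) * B <= H' ->
  (u |: S \in I -> gain f S u <= B) ->
  charged A S H B -> charged (A :\ u) S H' B.
Proof.
move=> B0 HH' bnd [D [E [cover sDO blocked chD chE]]].
exists D, (if u |: S \in I then u |: E else E); split=> // [v vO|].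
- have := cover v vO; rewrite !inE.
  case: (v =P u) => [->|_] /=.
    by case: (u |: S \in I); rewrite ?inE ?eqxx /= ?andbF ?orbT.
  case/or4P=> [->//|->|vE|->]; rewrite ?orbT //.
  by case: ifP; rewrite ?inE vE !orbT.
- have eB : 0 <= (1 - eps) * B by rewrite mulr_ge0 // ltW.
  case: ifP => [uS|_]; last by lra.
  have : \sum_(v in u |: E) pos_gain f S v <= \sum_(v in E) pos_gain f S v + B.
    case: (boolP (u \in E)) => uE; last first.
      by rewrite big_setU1 //= addrC lerD2l pos_gain_le ?bnd.
    by rewrite (setUidPr _) ?sub1set // lerDl.
  rewrite -(@ler_pM2l _ (1 - eps)) //.
  lra.
Qed.

Lemma charged_final (A S : {set T}) (H B : R) :
  0 <= B -> S \in I ->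
  (forall u, u \in A -> u |: S \in I -> gain f S u <= B) ->
  charged A S H B ->
  (1 - eps) * (f (O :|: S) - f S) <=
    k * (f S - f set0) + H + #|T|%:R * ((1 - eps) * B).
Proof.
move=> B0 SI bnd [D [E [cover sDO blocked chD chE]]].
have : \sum_(u in O) pos_gain f S u <= \sum_(u in D) pos_gain f S u +
    \sum_(u in E) pos_gain f S u + #|T|%:R * B.
  rewrite mulr_natl -sumr_const !(big_mkcond (fun u => u \in _)) /=.
  rewrite -!big_split /=; apply: ler_sum => u _.
  have p0 := pos_gain_ge0 f S u.
  have addp (b : bool) : 0 <= (if b then pos_gain f S u else 0) by case: b.
  case: ifP => [uO|_]; last by rewrite !addr_ge0.
  case/or4P: (cover u uO) => [uS|->|->|/andP[uA uI]].
  - by rewrite {1}/pos_gain gain_mem // maxxx !addr_ge0.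
  - by rewrite -addrA lerDl addr_ge0.
  - by rewrite addrAC lerDr addr_ge0.
  - by apply: le_trans (pos_gain_le B0 (bnd _ uA uI)) _; rewrite lerDr addr_ge0.
have := value_union_le f_sub O S.
set x := \sum_(u in O) _; set y := \sum_(u in D) _; set z := \sum_(u in E) _.
move=> le1 le2; have le3 : f (O :|: S) - f S <= y + z + #|T|%:R * B by lra.
(* The unspent credit is nonnegative and is dropped. *)
have cD : (1 - eps) * y <= k * (f S - f set0).
  apply: le_trans chD; rewrite ler_pM2l // lerDl mulr_ge0 // subr_ge0.
  exact: card_blocked_le ksys O_indep SI sDO blocked.
move: le3; rewrite -(@ler_pM2l _ (1 - eps)) //; move: cD chE; rewrite -/z; lra.
Qed.

End Charging.

(** * The invariant along a run *)

Section Run.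

Variables (R : realType) (T : finType) (f : {set T} -> R) (I : {set {set T}}).
Variables (k eps Delta : R) (O : {set T}) (l : nat).
Hypotheses (ksys : k_system k I) (k_ge0 : 0 <= k).
Hypotheses (eps_gt0 : 0 < eps) (eps_lt1 : eps < 1).
Hypotheses (f_ge0 : nonnegative f) (f_sub : submodular f) (O_indep : O \in I).
Hypothesis single_indep : forall u : T, [set u] \in I.
Hypothesis Delta_ge : forall u : T, f [set u] <= Delta.
Hypothesis Delta_attained : exists u : T, f [set u] = Delta.

Let subeps_gt0 : 0 < 1 - eps. Proof. by rewrite subr_gt0. Qed.

Definition unblocked_gain_le (s : sgs_state T l) (b : R) (u : T) (j : 'I_l) :
    Prop :=
  u \in avail s -> u |: sol s j \in I -> gain f (sol s j) u <= b.

(** [B] is the threshold of the last completed pass, initially [Delta]. It stays fixed during a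
    pass, while additions are made at [tau >= (1 - eps) * B]; this gap is the source of the factor
    [1 - eps]. [inv_start] serves to absorb the tail [eps * Delta]. *)
Record sgs_inv (B : R) (s : sgs_state T l) : Prop := SGSInv {
  inv_indep : forall j, sol s j \in I;
  inv_avail : forall j u, u \in sol s j -> u \notin avail s;
  inv_disjoint : forall i j u, u \in sol s i -> u \in sol s j -> i = j;
  inv_bound : forall u j, unblocked_gain_le s B u j;
  inv_charged : forall j, charged f I k eps O (avail s) (sol s j)
    (\sum_(i | i != j) (f (sol s i) - f set0)) B;
  inv_start : (avail s = [set: T] /\ forall j, sol s j = set0) \/
    exists j, (1 - eps) * Delta <= f (sol s j)
}.

Lemma sgs_inv_init : sgs_inv Delta (sgs_init T l).
Proof.
split=> [j|j u|i j u|u j|j|] /=.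
- rewrite ffunE; have [[_ down] _] := ksys; have [u _] := Delta_attained.
  exact: down (sub0set _) (single_indep u).
- by rewrite ffunE inE.
- by rewrite !ffunE inE.
- rewrite /unblocked_gain_le /= ffunE /gain setU0 => _ _.
  by have := Delta_ge u; have := f_ge0 set0; lra.
- rewrite big1 => [|i _]; last by rewrite ffunE subrr.
  by rewrite ffunE; apply: charged_init.
- by left; split=> // j; rewrite ffunE.
Qed.

Lemma sgs_pairP (tau : R) (u : T) (j : 'I_l) (s : sgs_state T l) :
  [/\ u \in avail s, u |: sol s j \in I, tau <= gain f (sol s j) u
    & (sgs_pair f I tau (u, j) s).2 = sgs_add u j s] \/
  (sgs_pair f I tau (u, j) s).2 = s /\
  (u \in avail s -> u |: sol s j \in I -> gain f (sol s j) u < tau).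
Proof.
rewrite /sgs_pair; case: (boolP (u \in avail s)) => [uA|_]; last by right.
rewrite /ask_indep /cbind /=.
case: (boolP (u |: sol s j \in I)) => [uI|_] /=; last by right.
case: leP => [le_tau|lt_tau]; first by left.
by right.
Qed.

Lemma unblocked_gain_le_add (b : R) (s : sgs_state T l) (u v : T)
    (i j : 'I_l) :
  unblocked_gain_le s b v i -> (v \in avail s -> v \notin sol s i) ->
  unblocked_gain_le (sgs_add u j s) b v i.
Proof.
move=> bnd vS; rewrite /unblocked_gain_le /sgs_add /= ffunE.
rewrite in_setD1 => /andP[vu vA]; case: eqP => [_|_]; last exact: bnd.
have [[_ down] _] := ksys => vI.
apply: le_trans (bnd vA (down _ _ _ vI)); last by rewrite setUS ?subsetUr.
apply: gain_antitone => //; first exact: subsetUr.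
by rewrite in_setU1 negb_or vu vS.
Qed.

Lemma sgs_inv_add (B tau : R) (s : sgs_state T l) (u : T) (j : 'I_l) :
  0 <= B -> 0 < tau -> (1 - eps) * B <= tau -> u \in avail s ->
  u |: sol s j \in I -> tau <= gain f (sol s j) u ->
  sgs_inv B s -> sgs_inv B (sgs_add u j s).
Proof.
move=> B0 tau0 Btau uA uI gu [indep av disj bnd ch start].
have notsol i : u \notin sol s i.
  by apply/negP => /av; rewrite uA.
split=> [i|i v|i1 i2 v|v i|i|] /=.
- by rewrite ffunE; case: eqP => [->|].
- rewrite ffunE in_setD1 negb_and; case: ifP => [_|_ /av ->]; last first.
    by rewrite orbT.
  by rewrite in_setU1 => /orP[->//|/av ->]; rewrite orbT.
- rewrite !ffunE; case: eqP => [->|_]; case: eqP => [->|_] //.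
  + rewrite in_setU1 => /orP[/eqP->|]; last exact: disj.
    by rewrite (negPf (notsol _)).
  + rewrite in_setU1 => vi /orP[/eqP vu|]; last exact: disj vi.
    by move: vi; rewrite vu (negPf (notsol _)).
  + exact: disj.
- by apply: unblocked_gain_le_add => // vA; apply/negP => /av; rewrite vA.
- rewrite ffunE; case: eqP => [->|/eqP ij].
    have -> : \sum_(i' | i' != j) (f ([ffun i0 => if i0 == j then u |: sol s i0
        else sol s i0] i') - f set0) =
        \sum_(i' | i' != j) (f (sol s i') - f set0).
      by apply: eq_bigr => i' /negPf i'j; rewrite ffunE i'j.
    apply: (charged_add_self ksys k_ge0 eps_lt1 f_sub B0 tau0 Btau gu _ (ch j)).
    by move=> v; apply: bnd.
  apply: charged_add_other (ch i) => //; last exact: bnd.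
  rewrite (bigD1 j) 1?eq_sym //= [X in _ <= X](bigD1 j) 1?eq_sym //=.
  rewrite ffunE eqxx.
  set x := \sum_(i' < l | _) _; set y := \sum_(i' < l | _) _.
  have -> : y = x.
    by apply: eq_bigr => i' /andP[_ /negPf i'j]; rewrite ffunE i'j.
  by move: gu; rewrite /gain; lra.
- right; case: start => [[avT empty]|[i le_i]].
    exists j; rewrite ffunE eqxx empty setU0.
    (* For the first addition, an element attaining [Delta] is still available, so
       [Delta - f set0 <= B], and the added gain is at least [1 - eps] times this. *)
    have [u0 u0D] := Delta_attained.
    have := bnd u0 j; rewrite /unblocked_gain_le empty avT inE /gain setU0 u0D.
    move=> /(_ isT (single_indep u0)); move: gu; rewrite empty /gain setU0.
    move=> gu; rewrite -(@ler_pM2l _ (1 - eps)) // mulrBr.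
    have : (1 - eps) * f set0 <= f set0.
      by have := mulr_ge0 (ltW eps_gt0) (f_ge0 set0); lra.
    lra.
  (* Later additions have positive gain and preserve the bound. *)
  exists i; rewrite ffunE; case: eqP => [ij|//].
  by move: gu; rewrite -ij /gain; lra.
Qed.

Lemma sgs_inv_bound_le (B B' : R) (s : sgs_state T l) :
  B' <= B -> (forall u j, unblocked_gain_le s B' u j) ->
  sgs_inv B s -> sgs_inv B' s.
Proof.
move=> leB bnd' [indep av disj bnd ch start]; split=> // j.
exact: charged_bound_le (ch j).
Qed.

(** [P] records the pairs already tried in this pass; the bound [tau] obtained for them survives
    later additions by submodularity and down-closure. *)
Lemma sgs_inv_foldl (B tau : R) (ps : seq (T * 'I_l)) (P : T -> 'I_l -> Prop)
    (m : counted (sgs_state T l)) :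
  0 <= B -> 0 < tau -> (1 - eps) * B <= tau -> sgs_inv B m.2 ->
  (forall u j, P u j -> unblocked_gain_le m.2 tau u j) ->
  let s := (foldl (fun m p => cbind m (sgs_pair f I tau p)) m ps).2 in
  sgs_inv B s /\
  forall u j, P u j \/ (u, j) \in ps -> unblocked_gain_le s tau u j.
Proof.
move=> B0 tau0 Btau; elim: ps P m => [|[u j] ps IHps] P m inv hP /=.
  by split=> // u j [/hP|].
pose P' v i := P v i \/ (v, i) = (u, j).
case: (IHps P' (cbind m (sgs_pair f I tau (u, j)))) => [|v i|inv' h'].
- rewrite /cbind /=; case: (sgs_pairP tau u j m.2) => [[uA uI gu ->]|[-> _] //].
  exact: sgs_inv_add gu inv.
- rewrite /cbind [_.2]/=.
  case: (sgs_pairP tau u j m.2) => [[uA uI gu ->]|[-> lt_gu]]; last first.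
    by case=> [/hP//|[-> ->] uA uI]; rewrite ltW // lt_gu.
  case=> [/hP bnd|[-> ->]]; last first.
    by rewrite /unblocked_gain_le /= !inE eqxx.
  apply: unblocked_gain_le_add bnd _ => vA; apply/negP.
  by move/(inv_avail inv); rewrite vA.
split=> // v i [Pvi|]; first by apply: h'; left; left.
by rewrite inE => /orP[/eqP vi|vi]; apply: h'; [left; right|right].
Qed.

(* Every pair has been tried at threshold [tau], so [tau] becomes the bound. *)
Lemma sgs_inv_pass (B tau : R) (ps : seq (T * 'I_l)) (s : sgs_state T l) :
  0 <= B -> 0 < tau -> (1 - eps) * B <= tau -> tau <= B ->
  perm_eq ps (enum [set: T * 'I_l]) ->
  sgs_inv B s -> sgs_inv tau (sgs_pass f I tau ps s).2.
Proof.
move=> B0 tau0 Btau tauB perm_ps inv.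
have [//|inv' bnd'] :=
  @sgs_inv_foldl B tau ps (fun _ _ => False) (cret s) B0 tau0 Btau inv.
apply: sgs_inv_bound_le tauB _ inv' => u j; apply: bnd'; right.
by rewrite (perm_mem perm_ps) mem_enum in_setT.
Qed.

(** The last disjunction counts the first two passes: since [thr < (1 - eps) * Delta] unless
    [Delta = 0], the loop cannot stop before both are done, whence the final bound
    [B' <= (1 - eps) * Delta]. *)
Lemma sgs_inv_loop (thr B tau : R) (ord : nat -> seq (T * 'I_l)) (i : nat)
    (m r : counted (sgs_state T l)) :
  0 <= thr -> thr < (1 - eps) * Delta \/ Delta = 0 -> schedule ord ->
  sgs_loop f I eps thr ord i tau m r ->
  0 <= B -> (1 - eps) * B <= tau -> tau <= B -> sgs_inv B m.2 ->
  (B = Delta /\ (tau = Delta \/ tau = (1 - eps) * Delta)) \/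
    B <= (1 - eps) * Delta ->
  exists B', [/\ 0 <= B', sgs_inv B' r.2, (1 - eps) * B' <= thr
    & B' <= (1 - eps) * Delta].
Proof.
move=> thr0 thrD sched loop; elim: loop B => {i tau m r}.
  move=> i tau m /negP; rewrite -leNgt => tau_thr B B0 Btau tauB inv cases.
  exists B; split=> //; first exact: le_trans tau_thr.
  case: cases => // -[BD tauD].
  have : (1 - eps) * Delta <= tau.
    by case: tauD => ->; have := mulr_ge0 (ltW eps_gt0) B0; rewrite BD; lra.
  by case: thrD => [|D0 _]; [lra|rewrite BD D0 mulr0].
move=> i tau m r thr_tau _ IH B B0 Btau tauB inv cases.
have tau0 : 0 < tau by apply: le_lt_trans thr_tau.
have etau := mulr_ge0 (ltW eps_gt0) (ltW tau0).
apply: (IH tau) => //; [exact: ltW|by lra| |].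
  by rewrite /cbind /=; apply: sgs_inv_pass (sched i) inv.
case: cases => [[BD [->|->]]|]; [by left; split; [|right]|by right|].
by right; apply: le_trans tauB _.
Qed.

End Run.

(** * Consequences of the invariant at termination *)

Section FinalState.

Variables (R : realType) (T : finType) (f : {set T} -> R) (I : {set {set T}}).
Variables (k eps Delta : R) (O : {set T}) (l : nat).
Variables (B : R) (s : sgs_state T l) (j : 'I_l).
Hypotheses (ksys : k_system k I) (k_ge1 : 1 <= k).
Hypotheses (eps_gt0 : 0 < eps) (eps_lt12 : eps < 1 / 2).
Hypotheses (f_ge0 : nonnegative f) (f_sub : submodular f) (O_indep : O \in I).
Hypothesis single_indep : forall u : T, [set u] \in I.
Hypothesis Delta_attained : exists u : T, f [set u] = Delta.
Hypotheses (B_ge0 : 0 <= B) (inv : sgs_inv f I k eps Delta O B s).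
Hypothesis B_thr : (1 - eps) * B <= eps / #|T|%:R * Delta.
Hypothesis best : forall i, f (sol s i) <= f (sol s j).

Let subeps_gt0 : 0 < 1 - eps. Proof. by move: eps_lt12; lra. Qed.

Let cardT_gt0 : 0 < #|T|%:R :> R.
Proof.
by rewrite ltr0n; have [u _] := Delta_attained; apply/card_gt0P; exists u.
Qed.

Lemma final_union_le :
  (1 - eps) * \sum_i f (O :|: sol s i) <=
  l%:R * ((k + l%:R - eps) * f (sol s j) - (k + l%:R - 1) * f set0 +
          eps * Delta).
Proof.
have tail : #|T|%:R * ((1 - eps) * B) <= eps * Delta.
  rewrite (le_trans (ler_wpM2l (ltW cardT_gt0) B_thr)) //.
  by rewrite mulrA mulrCA divff ?mulr1 // gt_eqF.
have total : \sum_i (f (sol s i) - f set0) <= l%:R * (f (sol s j) - f set0).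
  rewrite -[X in X%:R * _](card_ord l) mulr_natl -sumr_const.
  by apply: ler_sum => i _; rewrite lerD2r.
rewrite -[X in _ <= X%:R * _](card_ord l) mulr_natl -sumr_const mulr_sumr.
apply: ler_sum => i _.
have eps1 : eps < 1 by move: eps_lt12; lra.
have := charged_final ksys eps1 f_sub O_indep B_ge0 (inv_indep inv i) _
  (inv_charged inv i).
move=> /(_ (fun u => inv_bound inv (u := u) (j := i))).
move: total; rewrite (bigD1 i) //=; set h := \sum_(i' | _) _ => total.
(* After moving [(1 - eps) * f (sol s i)] across and writing [h] as the total minus the i-th term,
   [f (sol s i)] has coefficient [k - eps >= 0], so the best value may replace it. *)
have := ler_wpM2l _ (best i) (x := k - eps).
rewrite subr_ge0 => /(_ (ltW (lt_le_trans eps1 k_ge1))).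
by move: (f (O :|: _)) (f (sol s i)) (f (sol s j)) total tail => x y z; lra.
Qed.

Lemma final_Delta_le : B <= (1 - eps) * Delta ->
  (1 - eps) * Delta <= f (sol s j) \/
  f (sol s j) = f set0 /\ Delta <= 3 * f set0.
Proof.
move=> BD; case: (inv_start inv) => [[avT empty]|[i le_i]]; last first.
  by left; apply: le_trans le_i (best i).
right; rewrite empty; split=> //.
have [u0 u0D] := Delta_attained; have D0 : 0 <= Delta by rewrite -u0D.
have := inv_bound inv (u := u0) (j := j).
rewrite /unblocked_gain_le empty avT inE /gain setU0 u0D.
move=> /(_ isT (single_indep u0)) DB.
have thrD : eps / #|T|%:R * Delta <= eps * Delta.
  by rewrite ler_wpM2r // ler_pdivrMr // ler_pMr // ler1n -(ltr0n R).
move: B_thr BD eps_lt12 => Bthr BD' e12.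
(* When nothing was added, [Delta - f set0 <= B]. Either bound on [B], chosen according to [eps],
   gives [B <= (2 / 3) * Delta], hence the constant 3. *)
have [eps3|eps3] := lerP eps (1 / 3); last first.
  have : (1 - eps) * Delta <= (2 / 3) * Delta by rewrite ler_wpM2r //; lra.
  lra.
have : eps * Delta <= (1 / 3) * Delta by rewrite ler_wpM2r.
have : (2 / 3) * B <= (1 - eps) * B by rewrite ler_wpM2r //; lra.
lra.
Qed.

End FinalState.

(** * Termination and the number of oracle calls *)

Section OracleCalls.

Variables (R : realType) (T : finType) (f : {set T} -> R) (I : {set {set T}}).
Variable l : nat.

Lemma ask_valuesE (Ss : seq {set T}) :
  ask_values f Ss = (size Ss, map f Ss).
Proof.
elim: Ss => [|A Ss IH] //; rewrite [LHS]/= IH /cbind /cret /=.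
by rewrite addn0 add1n.
Qed.

Lemma ask_DeltaE : ask_Delta f = (#|T|, \big[Num.max/0]_u f [set u]).
Proof.
rewrite /ask_Delta ask_valuesE /cbind /cret /= addn0 size_map -cardE.
by rewrite !big_map [index_enum _]unlock.
Qed.

Lemma sgs_pair_calls (tau : R) (p : T * 'I_l) (s : sgs_state T l) :
  ((sgs_pair f I tau p s).1 <= 3)%N.
Proof.
by case: p => u j; rewrite /sgs_pair /cbind /=; do 2?case: ifP.
Qed.

Lemma sgs_pass_calls (tau : R) (ps : seq (T * 'I_l)) (s : sgs_state T l) :
  ((sgs_pass f I tau ps s).1 <= 3 * size ps)%N.
Proof.
suff H m : ((foldl (fun m p => cbind m (sgs_pair f I tau p)) m ps).1 <=
    m.1 + 3 * size ps)%N by have := H (cret s).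
elim: ps m => [|p ps IH] m /=; first by rewrite muln0 addn0.
apply: leq_trans (IH _) _; rewrite /= mulnS addnA leq_add2r leq_add2l.
exact: sgs_pair_calls.
Qed.

Variables (eps thr : R) (ord : nat -> seq (T * 'I_l)).

Lemma sgs_loop_halts (d i : nat) (tau : R) (m : counted (sgs_state T l)) :
  (1 - eps) ^+ d * tau <= thr -> exists r, sgs_loop f I eps thr ord i tau m r.
Proof.
elim: d i tau m => [|d IHd] i tau m.
  rewrite expr0 mul1r => tau_thr; exists m; apply: SGSStop.
  by apply/negP; rewrite -leNgt.
rewrite exprSr -mulrA => tau_thr; have [le_tau|lt_tau] := lerP tau thr.
  by exists m; apply: SGSStop; apply/negP; rewrite -leNgt.
have [r loop] := IHd i.+1 _ (cbind m (sgs_pass f I tau (ord i))) tau_thr.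
by exists r; apply: SGSStep.
Qed.

Lemma sgs_loop_calls (d i : nat) (tau : R) (m r : counted (sgs_state T l)) :
  schedule ord -> (1 - eps) ^+ d * tau <= thr ->
  sgs_loop f I eps thr ord i tau m r ->
  (r.1 <= m.1 + d * (3 * (#|T| * l)))%N.
Proof.
move=> sched le_thr loop; elim: loop d le_thr => {i tau m r}.
  by move=> *; apply: leq_addr.
move=> i tau m r lt_tau _ IH [|d].
  by rewrite expr0 mul1r leNgt lt_tau.
rewrite exprSr -mulrA => /IH le_r; apply: leq_trans le_r _.
rewrite /= mulSn -addnA leq_add2l leq_add2r.
apply: leq_trans (sgs_pass_calls _ _ _) _.
by rewrite (perm_size (sched i)) -cardE cardsT card_prod card_ord.
Qed.

End OracleCalls.

(** * Numerical estimates *)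

Section Bounds.

Variable R : realType.

Lemma subr_exp_le (eps x : R) (d : nat) :
  0 < eps < 1 -> 0 < x -> ln x / eps <= d%:R -> (1 - eps) ^+ d <= x^-1.
Proof.
move=> /andP[eps0 eps1] x0; rewrite ler_pdivrMr // => le_d.
apply: (@le_trans _ _ (expR (- eps) ^+ d)).
  rewrite lerXn2r ?nnegrE ?subr_ge0 ?expR_ge0 //; first exact: ltW.
  exact: expR_ge1Dx.
rewrite -expRM_natl -[x in x^-1]lnK ?posrE // -expRN ler_expR mulrN lerN2.
exact: le_d.
Qed.

(** The count is at most [12 * (h * ln h) + 17 * (k * n)], and [k * n <= h / 2 <= h * ln h]; the
    constant 46 leaves slack. *)
Lemma polylog_calls_le (k eps n l d : R) :
  1 <= k -> 0 < eps < 1 / 2 -> 1 <= n -> 0 <= l -> l <= 4 * k ->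
  d <= ln (n / eps) / eps + 1 ->
  n + d * (3 * (n * l)) + l <= polylog_bound 46 1 (k * n / eps).
Proof.
move=> k1 /andP[eps0 eps12] n1 l0 l4 dle; rewrite /polylog_bound expr1.
set h := k * n / eps.
have kn : 1 <= k * n by rewrite -[1]mulr1 ler_pM.
have n0 : 0 < n by lra.
have ne0 : 0 < n / eps by rewrite divr_gt0.
have h_kn : 2 * (k * n) <= h.
  rewrite /h ler_pdivlMr // -mulrA mulrCA ger_pMr; lra.
have h2 : 2 <= h by lra.
have lnh : 1 / 2 <= ln h.
  have : ln (2 : R) <= ln h by rewrite ler_ln ?posrE //; lra.
  have /le_ln1Dx : -1 < - (1 / 2) :> R by lra.
  have -> : 1 + - (1 / 2) = 2^-1 :> R by lra.
  by rewrite lnV ?posrE; lra.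
have lnn : ln (n / eps) <= ln h.
  rewrite ler_ln ?posrE //; last by lra.
  by rewrite /h ler_pM2r ?invr_gt0 // ler_peMl // ltW.
have ln0 : 0 <= ln (n / eps).
  by apply: ln_ge0; rewrite ler_pdivlMr // mul1r; lra.
have d0 : 0 <= ln h / eps + 1 by rewrite addr_ge0 // divr_ge0 //; lra.
have d1 : d * (3 * (n * l)) <= (ln h / eps + 1) * (12 * (k * n)).
  apply: (@le_trans _ _ ((ln h / eps + 1) * (3 * (n * l)))).
    rewrite ler_wpM2r //; first by rewrite mulr_ge0 // mulr_ge0 // ltW.
    by apply: le_trans dle _; rewrite lerD2r ler_pM2r // invr_gt0.
  rewrite ler_wpM2l //.
  have := ler_wpM2l (ltW n0) l4; lra.
have e1 : ln h / eps * (12 * (k * n)) = 12 * (h * ln h).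
  by rewrite /h; field; rewrite gt_eqF.
have nkn : n <= k * n by rewrite ler_peMl // ltW.
have kkn : k <= k * n by rewrite ler_peMr //; lra.
have : h * (1 / 2) <= h * ln h by rewrite ler_wpM2l //; lra.
move: d1; rewrite [X in _ <= X -> _]mulrDl e1 mul1r; lra.
Qed.

(* With [x = l - 1], the identity [l (k + l) = x (s^2 + 2 s) + (x - s)^2 - 1]
   shows that [l = floor (2 + s)] gives at most [x (s^2 + 2 s)]. *)
Lemma simultaneous_ratio (k eps s l y F a Delta : R) :
  1 <= k -> 0 < eps < 1 / 2 -> 0 <= s -> s ^+ 2 = k + 2 ->
  2 <= l -> l <= 2 + s < l + 1 -> 0 <= y -> 0 <= F -> 0 <= a ->
  (1 - eps) * ((l - 1) * y) <=
    l * ((k + l - eps) * F - (k + l - 1) * a + eps * Delta) ->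
  (1 - eps) * Delta <= F \/ F = a /\ Delta <= 3 * a ->
  y / ((1 - 2 * eps) ^- 2 * (1 + s) ^+ 2) <= F.
Proof.
move=> k1 /andP[eps0 eps12] s0 s2 l2 /andP[ls sl] y0 F0 a0 main cases.
have e2 : 0 < (1 - 2 * eps) ^+ 2 by rewrite exprn_gt0 //; lra.
have s1 : 0 < (1 + s) ^+ 2 by rewrite exprn_gt0 //; lra.
rewrite ler_pdivrMr; last by rewrite mulr_gt0 ?invr_gt0.
rewrite mulrA -[F / _]mulrC -mulrA ler_pdivlMl //.
have xs : (l - 1 - s) ^+ 2 <= 1 ^+ 2 by rewrite ler_sqr ?nnegrE; lra.
have ll : l * (k + l) <= (l - 1) * (s ^+ 2 + 2 * s).
  have -> : k = s ^+ 2 - 2 by lra.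
  lra.
have llF := ler_wpM2r F0 ll.
(* Together with [llF] this gives the factor [s ^+ 2 + 2 * s + 1]. In the first case
   [eps * (Delta - F) <= F / 2], and [l / 2 <= l - 1]; in the second, [eps * Delta] is at most
   [(k + l - 1) * a]. *)
have tail : l * (- eps * F - (k + l - 1) * a + eps * Delta) <= (l - 1) * F.
  case: cases => [DF|[_ Da]].
    have D2 : Delta <= 2 * F by nra.
    have : eps * Delta <= eps * (2 * F) by rewrite ler_pM2l.
    have : 0 <= (k + l - 1) * a by rewrite mulr_ge0 //; lra.
    move=> h1 h2.
    have : - eps * F - (k + l - 1) * a + eps * Delta <= F / 2 by nra.
    by rewrite -(@ler_pM2l _ l); [nra|lra].
  have : eps * Delta <= (k + l - 1) * a by nra.
  have : 0 <= eps * F by rewrite mulr_ge0 // ltW.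
  nra.
have le1 : (1 - eps) * y <= F * (1 + s) ^+ 2.
  rewrite -(@ler_pM2l _ (l - 1)); last by lra.
  lra.
apply: le_trans le1; rewrite ler_wpM2r //; nra.
Qed.

(** The second factor [1 - eps] absorbs the tail: multiplied by it, [eps * Delta] costs at most
    [eps * F] in the first case, and [(1 - eps) * (k + 1 - eps) + eps <= k + 1]. *)
Lemma single_ratio (k eps y F a Delta : R) :
  1 <= k -> 0 < eps < 1 / 2 -> 0 <= F -> 0 <= a ->
  (1 - eps) * y <= (k + 1 - eps) * F - (k + 1 - 1) * a + eps * Delta ->
  (1 - eps) * Delta <= F \/ F = a /\ Delta <= 3 * a ->
  y / ((1 - eps) ^- 2 * (k + 1)) <= F.
Proof.
move=> k1 /andP[eps0 eps12] F0 a0 main cases.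
have e2 : 0 < (1 - eps) ^+ 2 by rewrite exprn_gt0 //; lra.
rewrite ler_pdivrMr; last by rewrite mulr_gt0 ?invr_gt0 //; lra.
rewrite mulrA -[F / _]mulrC -mulrA ler_pdivlMl // expr2 -mulrA.
have e1 : 0 <= 1 - eps by lra.
apply: le_trans (ler_wpM2l e1 main) _.
have kF : 0 <= eps * (k * F) by rewrite !mulr_ge0 //; lra.
have eF : 0 <= eps * F by rewrite mulr_ge0 // ltW.
have eeF : eps * (eps * F) <= eps * F by rewrite ler_piMl //; lra.
case: cases => [DF|[-> Da]].
  have : eps * ((1 - eps) * Delta) <= eps * F by rewrite ler_pM2l.
  have : 0 <= (1 - eps) * (k * a) by rewrite !mulr_ge0 //; lra.
  lra.
have : (1 - eps) * (eps * Delta) <= (1 - eps) * (eps * (3 * a)).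
  by rewrite ler_pM2l ?ler_pM2l //; lra.
nra.
Qed.

End Bounds.

(** * Assembly of the guarantees *)

(** Shared by both claims, which differ only in how the values [f (O :|: S i)] are bounded below and
    in the final arithmetic; these enter through the hypothesis on [alpha]. *)
Lemma fastSGS_guarantee_of_ratio (R : realType) (T : finType)
    (f : {set T} -> R) (I : {set {set T}}) (k eps alpha : R) (l : nat) :
  (0 < #|T|)%N -> 0 < eps < 1 / 2 -> k_system k I ->
  (forall u : T, [set u] \in I) -> nonnegative f -> submodular f ->
  (0 < l)%N -> l%:R <= 4 * k ->
  (forall (O : {set T}) (S : 'I_l -> {set T}) (F Delta : R),
    0 <= F -> (forall i j u, u \in S i -> u \in S j -> i = j) ->
    (1 - eps) * \sum_i f (O :|: S i) <=
      l%:R * ((k + l%:R - eps) * F - (k + l%:R - 1) * f set0 + eps * Delta) ->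
    (1 - eps) * Delta <= F \/ F = f set0 /\ Delta <= 3 * f set0 ->
    f O / alpha <= F) ->
  fastSGS_guarantee f I l eps (polylog_bound 46 1 (k * #|T|%:R / eps)) alpha.
Proof.
move=> T0 eps012 ksys sing f_ge0 f_sub l0 l4 ratio ord sched.
have /andP[eps0 eps12] := eps012.
have [u0 _] := card_gt0P T0.
have k1 : 1 <= k := k_system_ge1 ksys (sing u0).
have n1 : 1 <= #|T|%:R :> R by rewrite ler1n.
have n0 : 0 < #|T|%:R :> R by rewrite ltr0n.
have eps1 : eps < 1 by lra.
have eps_lt : eps < 1 - eps by lra.
have eps_le : 1 - eps <= 1 by lra.
have k0 : 0 <= k by lra.
have eps01 : 0 < eps < 1 by rewrite eps0.
rewrite /fastSGS_run ask_DeltaE /=.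
set Delta := \big[Num.max/0]_u f [set u].
have Delta_ge u : f [set u] <= Delta by apply: le_bigmax.
have Delta_attained : exists u, f [set u] = Delta.
  by exists [arg max_(i > u0) f [set i]]%O; rewrite /Delta (bigmax_eq_arg _ u0).
have Delta0 : 0 <= Delta := le_trans (f_ge0 _) (Delta_ge u0).
set thr := eps / #|T|%:R * Delta.
(* Enough passes for [(1 - eps) ^+ d <= eps / #|T|], by [1 - eps <= expR (- eps)]. *)
pose d := (Num.truncn (ln (#|T|%:R / eps) / eps)).+1.
have ne1 : 1 <= #|T|%:R / eps by rewrite ler_pdivlMr // mul1r; lra.
have le_d : (1 - eps) ^+ d * Delta <= thr.
  rewrite ler_wpM2r // -[eps / _]invrK invf_div; apply: subr_exp_le => //.
    by rewrite divr_gt0.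
  exact/ltW/truncnS_gt.
split.
  have [r loop] := sgs_loop_halts f I ord 0 (cbind (#|T|, Delta)
    (fun=> cret (sgs_init T l))) le_d.
  pose j := [arg max_(i > Ordinal l0) f (sol r.2 i)]%O.
  eexists (sol r.2 j), _, r; split=> //; exists j; split=> // i.
  by rewrite /j; case: arg_maxP => // j' _; apply.
move=> S q [r [loop -> [j [-> best]]]].
(* [O] belongs to the analysis only, so the same run satisfies the invariant for every independent
   [O]; a singleton suffices for the independence of the output. *)
have run O : O \in I -> exists B, [/\ 0 <= B, sgs_inv f I k eps Delta O B r.2,
    (1 - eps) * B <= thr & B <= (1 - eps) * Delta].
  move=> O_indep.
  apply: (sgs_inv_loop ksys k0 eps0 eps1 f_ge0 f_sub O_indep sing Delta_attained
    _ _ sched loop Delta0) => //.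
  - by rewrite mulr_ge0 // divr_ge0 // ltW.
  - have [->|D_neq0] := eqVneq Delta 0; [by right|left].
    have D_gt0 : 0 < Delta by rewrite lt_def D_neq0.
    rewrite ltr_pM2r // ltr_pdivrMr //.
    by apply: lt_le_trans eps_lt _; rewrite ler_peMr // subr_ge0 ltW.
  - exact: ler_piMl.
  - exact: sgs_inv_init.
  - by left; split=> //; left.
split.
- have := sgs_loop_calls sched le_d loop; rewrite ask_valuesE /= size_map.
  rewrite size_enum_ord addn0 => le_r.
  have dle : d%:R <= ln (#|T|%:R / eps) / eps + 1.
    rewrite /d -natr1 lerD2r truncn_le divr_ge0 ?ln_ge0 //; exact: ltW.
  apply: le_trans (polylog_calls_le k1 eps012 n1 (ler0n _ l) l4 dle).
  by rewrite natrD lerD2r -!natrM -natrD ler_nat.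
- by have [B [_ inv _ _]] := run _ (sing u0); apply: inv_indep inv j.
- move=> O O_indep _; have [B [B0 inv Bthr BD]] := run _ O_indep.
  apply: (ratio _ (sol r.2) _ Delta) (f_ge0 _) (inv_disjoint inv) _ _.
    exact: (final_union_le ksys k1 eps12 f_sub O_indep Delta_attained B0 inv).
  exact: (final_Delta_le eps0 eps12 f_ge0 sing Delta_attained B0 inv).
Qed.

Theorem theorem21 (R : realType) :
  exists (C : R) (c : nat),
  forall (T : finType) (I : {set {set T}}) (f : {set T} -> R) (k eps : R),
    (0 < #|T|)%N ->
    0 < eps < 1 / 2 ->
    k_system k I ->
    (forall u : T, [set u] \in I) ->
    nonnegative f ->
    submodular f ->
    fastSGS_guarantee f I (Num.truncn (2 + Num.sqrt (k + 2))) eps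
      (polylog_bound C c (k * #|T|%:R / eps))
      ((1 - 2 * eps) ^- 2 * (1 + Num.sqrt (k + 2)) ^+ 2)
    /\
    (monotone f ->
     fastSGS_guarantee f I 1 eps
       (polylog_bound C c (k * #|T|%:R / eps))
       ((1 - eps) ^- 2 * (k + 1))).
Proof.
exists 46, 1%N => T I f k eps T0 eps012 ksys sing f_ge0 f_sub.
have [u0 _] := card_gt0P T0.
have k1 : 1 <= k := k_system_ge1 ksys (sing u0).
have /andP[eps0 eps12] := eps012.
split=> [|f_mono]; last first.
  apply: fastSGS_guarantee_of_ratio => //; first by rewrite mulr1n; lra.
  (* With one solution, monotonicity gives [f O <= f (O :|: S)] directly, in place of averaging over
     disjoint solutions. *)
  move=> O S F Delta F0 _; rewrite big_ord1 mul1r => le_F cases.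
  apply: single_ratio cases => //; apply: le_trans le_F.
  by rewrite ler_wpM2l ?f_mono ?subsetUl //; lra.
set s := Num.sqrt (k + 2); set l := Num.truncn (2 + s).
have s0 : 0 <= s by apply: sqrtr_ge0.
have s2 : s ^+ 2 = k + 2 by rewrite sqr_sqrtr //; lra.
(* This yields [l <= k + 3 <= 4 * k], as the call count requires. *)
have sk : s <= k + 1 by nra.
have lE : l%:R <= 2 + s < l%:R + 1 by rewrite natr1; apply: truncn_itv; lra.
have l2 : (2 <= l)%N by rewrite truncn_ge_nat; lra.
apply: fastSGS_guarantee_of_ratio => //; first exact: leq_trans l2.
  by move/andP: lE => [le_l _]; lra.
move=> O S F Delta F0 disj le_F cases.
apply: (simultaneous_ratio k1 eps012 s0 s2 _ lE _ F0 (f_ge0 _)) cases => //.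
  by rewrite ler_nat.
apply: le_trans le_F; rewrite ler_pM2l; last by lra.
by have := sum_value_union_disjoint f_sub O f_ge0 disj; rewrite card_ord.
Qed.
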